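(* Let $D(0;1)=\{z\in\mathbb{C}:|z|<1\}$ and $S^1=\{z\in\mathbb{C}:|z|=1\}$. Let $f:D(0;1)\to\mathbb{C}$ be analytic with $|f(z)|\le 1$ for all $z\in D(0;1)$ and $f(0)=0$. Then the following hold. (1) There are complex numbers $a_n$, $n\ge 1$, such that $f(z)=\sum_{n=1}^{+\infty}a_nz^n$ for all $z\in D(0;1)$, and $$\sum_{n=1}^{+\infty}|a_n|^2\le 1\quad\text{and}\quad |f(z)|\le|z|\ \text{ for all } z\in D(0;1).$$ (2) For each $n\ge 1$, we have $|a_n|=1$ if and only if there is $\omega\in S^1$ such that $f(z)=\omega z^n$ for all $z\in D(0;1)$. (3) We have $|f(z)|=|z|$ for some $z\in D(0;1)$ with $z\ne 0$ if and only if there is $\omega\in S^1$ such that $f(z)=\omega z$ for all $z\in D(0;1)$.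
   Context: A function $f:\Omega\to\mathbb{C}$ on an open set $\Omega\subset\mathbb{C}$ is analytic if around each $z_0\in\Omega$ it is given on some open disk centered at $z_0$ and contained in $\Omega$ by a convergent power series in $z-z_0$. *)

(* Defs.v *)
From Stdlib Require Export Reals.
From Coquelicot Require Export Coquelicot.

Definition open_disk (c : C) (r : R) : C -> Prop :=
  fun z => (Cmod (z - c)%C < r)%R.

Definition unit_disk : C -> Prop := fun z => (Cmod z < 1)%R.

Definition unit_circle : C -> Prop := fun z => Cmod z = 1%R.

(* A function on [Omega] is encoded as a total function [C -> C]; its values
   outside [Omega] are never used.  [is_pseries] contains the convergence of
   the series.  The inclusion of the disk forces [Omega] to be open. *)
Definition analytic (Omega : C -> Prop) (f : C -> C) : Prop :=
  forall z0 : C, Omega z0 ->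
    exists (r : R) (a : nat -> C),
      (0 < r)%R /\
      (forall z : C, open_disk z0 r z -> Omega z) /\
      (forall z : C, open_disk z0 r z -> is_pseries a (z - z0)%C (f z)).

(* Main.v *)
Require Import Defs.
From mathcomp Require Import ssreflect.
From mathcomp Require ssrbool binomial.
From Stdlib Require Import Lra Lia Classical ClassicalEpsilon.

Local Open Scope R_scope.

Notation binom := binomial.binomial.

(** The proof uses neither integrals nor derivatives.  Everything comes from
    one inequality for power series, Bessel's inequality [bessel_disk]: if
    [sum_k a_k h^k] is bounded by [M] on the disk of radius [r], then
    [sum_k (|a_k| r^k)^2 <= M^2].  For a polynomial on a circle this is
    Parseval's identity averaged over the roots of unity
    ([parseval_roots_of_unity]); the remainder of the series is then sent to
    zero.  Cauchy's estimates, the uniqueness of the coefficients and the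
    rigidity statement [dominant_coefficient] (a single term that exhausts the
    bound kills all the others) are immediate consequences.

    Analyticity only gives local expansions, so the first point is that the
    expansion at 0 represents [f] on the whole unit disk.  Suppose that it does
    so on the disk of radius [r < 1].  By compactness [f] has expansions of one
    common radius [d] at all points of the closed disk of radius [r]; as
    [|f| <= 1], the [k]-th Taylor coefficient at each of them is at most
    [d^-k].  That coefficient, as a function of the centre, is the power series
    with coefficients [binom m k * a_m] ([represents_taylor_coef]), so a second
    Cauchy estimate gives [binom m k * |a_m| r^(m-k) d^k <= 1].  Summing over
    [k] with weights [2^-k] bounds [|a_m| (r + d/2)^m]
    ([coefficient_bound_past_radius]): the series converges beyond [r], and by
    recentring it still represents [f] there ([represents_extends]).  The
    supremum of the admissible radii is therefore 1.

    Write [f z = z * g z].  Schwarz's inequality is [|g| <= 1].  A maximum point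
    of [|g|] on a closed disk of radius [s < 1] either lies on the circle, where
    [|g| <= 1/s], or makes the Taylor series of [g] at that point constant; such
    a maximum propagates to the centre ([maximum_at_centre]), where
    [|g 0| = |a_1| <= 1].  Letting [s] tend to 1 gives [|g| <= 1], and Bessel's
    inequality for [g] is the bound on the sum of the squares.  The equality
    cases are rigidity: [|a_n| = 1] kills every other coefficient of [f], and
    [|f z| = |z|] makes [|g|] maximal at [z], hence [|a_1| = |g 0| = 1]. *)

(** * Finite sums *)

Lemma sum_n_S (u : nat -> C) (n : nat) :
  sum_n u (S n) = (sum_n u n + u (S n))%C.
Proof. exact: (sum_Sn u). Qed.

Lemma sum_n_SR (u : nat -> R) (n : nat) :
  sum_n u (S n) = sum_n u n + u (S n).
Proof. exact: (sum_Sn u). Qed.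

Lemma sum_n_le (u v : nat -> R) (n : nat) :
  (forall k, (k <= n)%nat -> u k <= v k) -> sum_n u n <= sum_n v n.
Proof.
elim: n => [|n IH] H; first by rewrite !sum_O; apply: H.
rewrite !sum_n_SR; apply: Rplus_le_compat; last by apply: H.
by apply: IH => k Hk; apply: H; lia.
Qed.

Lemma sum_n_ge0 (u : nat -> R) (n : nat) :
  (forall k, 0 <= u k) -> 0 <= sum_n u n.
Proof.
move=> H; elim: n => [|n IH]; first by rewrite sum_O.
by rewrite sum_n_SR; move: (H (S n)); lra.
Qed.

Lemma term_le_sum_n (u : nat -> R) (k n : nat) :
  (forall j, 0 <= u j) -> (k <= n)%nat -> u k <= sum_n u n.
Proof.
move=> H; elim: n => [|n IH] Hk.
  have -> : k = O by lia.
  by rewrite sum_O; lra.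
rewrite sum_n_SR; case: (Nat.eq_dec k (S n)) => [->|Hne].
  by move: (sum_n_ge0 u n H); lra.
by move: (IH ltac:(lia)) (H (S n)); lra.
Qed.

Lemma Cmod_sum_n (u : nat -> C) (n : nat) :
  Cmod (sum_n u n) <= sum_n (fun k => Cmod (u k)) n.
Proof.
elim: n => [|n IH]; first by rewrite !sum_O; lra.
rewrite sum_n_S sum_n_SR.
by move: (Cmod_triangle (sum_n u n) (u (S n))); lra.
Qed.

Lemma two_terms_le_sum_n (u : nat -> R) (i j n : nat) :
  (forall k, 0 <= u k) -> i <> j -> (i <= n)%nat -> (j <= n)%nat ->
  u i + u j <= sum_n u n.
Proof.
move=> Hu; elim: n i j => [|n IH] i j Hij Hi Hj; first by lia.
rewrite sum_n_SR.
case: (Nat.eq_dec i (S n)) => Hi'.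
  by rewrite Hi'; have := term_le_sum_n u j n Hu ltac:(lia); lra.
case: (Nat.eq_dec j (S n)) => Hj'.
  by rewrite Hj'; have := term_le_sum_n u i n Hu ltac:(lia); lra.
by have := IH i j Hij ltac:(lia) ltac:(lia); have := Hu (S n); lra.
Qed.

Lemma sum_n_Cext (u v : nat -> C) (n : nat) :
  (forall k, (k <= n)%nat -> u k = v k) -> sum_n u n = sum_n v n.
Proof. exact: sum_n_ext_loc. Qed.

Lemma sum_n_Czero (n : nat) : sum_n (fun _ => RtoC 0) n = RtoC 0 :> C.
Proof.
elim: n => [|n IH]; first by rewrite sum_O.
by rewrite sum_n_S IH; ring.
Qed.

Lemma sum_n_Cscal (c : C) (u : nat -> C) (n : nat) :
  sum_n (fun k => (c * u k)%C) n = (c * sum_n u n)%C.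
Proof. exact: (sum_n_mult_l (K := C_Ring) c u n). Qed.

Lemma sum_n_Rscal (c : R) (u : nat -> R) (n : nat) :
  sum_n (fun k => c * u k) n = c * sum_n u n.
Proof. exact: (sum_n_mult_l (K := R_Ring) c u n). Qed.

Lemma sum_n_Rplus (u v : nat -> R) (n : nat) :
  sum_n (fun k => u k + v k) n = sum_n u n + sum_n v n.
Proof. exact: (sum_n_plus (G := R_AbelianMonoid) u v n). Qed.

Lemma sum_n_Rconst (c : R) (n : nat) : sum_n (fun _ => c) n = INR (S n) * c.
Proof. by rewrite /sum_n sum_n_m_const Nat.sub_0_r. Qed.

Lemma sum_n_Re (u : nat -> C) (n : nat) :
  Re (sum_n u n) = sum_n (fun k => Re (u k)) n.
Proof.
elim: n => [|n IH]; first by rewrite !sum_O.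
by rewrite sum_n_S sum_n_SR -IH.
Qed.

Lemma sum_n_Cconj (u : nat -> C) (n : nat) :
  Cconj (sum_n u n) = sum_n (fun k => Cconj (u k)) n.
Proof.
elim: n => [|n IH]; first by rewrite !sum_O.
by rewrite !sum_n_S -IH Cplus_conj.
Qed.

(** * Series *)

Lemma Cmod_RtoC_pos (r : R) : 0 <= r -> Cmod (RtoC r) = r.
Proof. by move=> Hr; rewrite Cmod_R Rabs_pos_eq. Qed.

Lemma is_series_C_iff (u : nat -> C) (l : C) :
  is_series u l <-> is_lim_seq (fun n => Cmod (sum_n u n - l)%C) 0.
Proof.
split=> H.
- apply/is_lim_seq_spec => eps.
  have [N HN] : eventually (fun n => ball_norm l eps (sum_n u n)).
    by apply: H; apply: locally_le_locally_norm; exists eps.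
  exists N => n Hn; move: (HN n Hn); rewrite /ball_norm => H'.
  rewrite Rminus_0_r Rabs_pos_eq //; exact: Cmod_ge_0.
- move=> P /(locally_norm_le_locally (V := C_NormedModule)) [eps Heps].
  have [N HN] := proj2 (is_lim_seq_spec _ _) H eps.
  exists N => n Hn; apply: Heps; rewrite /ball_norm.
  move: (HN n Hn); rewrite Rminus_0_r Rabs_pos_eq //; exact: Cmod_ge_0.
Qed.

(** The next five lemmas restate general facts about series with the concrete
    operations of [C], so that [ring] and [rewrite] apply to the results. *)
Lemma Cseries_unique (u : nat -> C) (l1 l2 : C) :
  is_series u l1 -> is_series u l2 -> l1 = l2.
Proof.
exact: (filterlim_locally_unique (V := C_NormedModule) (F := eventually) (sum_n u)).
Qed.

Lemma Cseries_ext (u v : nat -> C) (l : C) :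
  (forall n, u n = v n) -> is_series u l -> is_series v l.
Proof. exact: is_series_ext. Qed.

Lemma Cseries_plus (u v : nat -> C) (l m : C) :
  is_series u l -> is_series v m ->
  is_series (fun n => (u n + v n)%C) (l + m)%C.
Proof. exact: (is_series_plus u v). Qed.

Lemma Cseries_scal (c : C) (u : nat -> C) (l : C) :
  is_series u l -> is_series (fun n => (c * u n)%C) (c * l)%C.
Proof. exact: (is_series_scal c u). Qed.

Lemma Cseries_minus (u v : nat -> C) (l m : C) :
  is_series u l -> is_series v m ->
  is_series (fun n => (u n - v n)%C) (l - m)%C.
Proof. exact: (is_series_minus u v). Qed.

(** The value is arbitrary when the series diverges; totality allows Taylor
    coefficients, which are sums of series, to be written as terms. *)
Definition csum (u : nat -> C) : C :=
  iota (T := C_CompleteNormedModule) (fun l : C => is_series u l).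

Lemma csum_correct (u : nat -> C) :
  ex_series (fun n => Cmod (u n)) -> is_series u (csum u).
Proof.
move=> H.
have [l Hl] : exists l : C, is_series u l.
  apply: (ex_series_le (V := C_CompleteNormedModule) u _ _ H) => n; exact: Rle_refl.
apply: (iota_correct (V := C_CompleteNormedModule) (fun l : C => is_series u l)).
by exists l; split=> // l' Hl'; apply: Cseries_unique Hl Hl'.
Qed.

Lemma Cseries_sum_n (u : nat -> nat -> C) (l : nat -> C) (n : nat) :
  (forall k, is_series (u k) (l k)) ->
  is_series (fun m => sum_n (fun k => u k m) n) (sum_n l n).
Proof.
move=> H; elim: n => [|n IH].
  by rewrite sum_O; apply: Cseries_ext (H O) => m; rewrite sum_O.
rewrite sum_n_S; apply: Cseries_ext (Cseries_plus _ _ _ _ IH (H (S n))) => m.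
by rewrite sum_n_S.
Qed.

(** Domination of a complex series by a real one, in the quantitative form for the
    remainders: the partial sums satisfy it by the triangle inequality, and it
    passes to the limit. *)
Lemma Cseries_tail_bound (u : nat -> C) (v : nat -> R) (l : C) (L : R) (n : nat) :
  (forall k, Cmod (u k) <= v k) -> is_series u l -> is_series v L ->
  Cmod (l - sum_n u n)%C <= L - sum_n v n.
Proof.
move=> Huv Hu Hv.
have Hd p : Cmod (sum_n u (n + p) - sum_n u n)%C <= sum_n v (n + p) - sum_n v n.
  elim: p => [|p IH].
    rewrite Nat.add_0_r.
    have -> : (sum_n u n - sum_n u n)%C = RtoC 0 by ring.
    by rewrite Cmod_0; lra.
  rewrite Nat.add_succ_r sum_n_S sum_n_SR.
  have -> : (sum_n u (n + p) + u (S (n + p)) - sum_n u n)%C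
    = ((sum_n u (n + p) - sum_n u n) + u (S (n + p)))%C by ring.
  move: (Cmod_triangle (sum_n u (n + p) - sum_n u n)%C (u (S (n + p)))).
  by move: (Huv (S (n + p))); lra.
have H1 : is_lim_seq (fun p => Cmod (sum_n u (p + n) - l)%C) 0.
  by apply/(is_lim_seq_incr_n (fun p => Cmod (sum_n u p - l)%C))/is_series_C_iff.
have H2 : is_lim_seq (fun p => sum_n v (p + n)) L.
  by apply/(is_lim_seq_incr_n (sum_n v)).
have H3 := is_lim_seq_minus' _ _ _ _ (is_lim_seq_plus' _ _ _ _ H1 H2)
  (is_lim_seq_const (sum_n v n)).
have := is_lim_seq_le _ _ _ _ _ (is_lim_seq_const (Cmod (l - sum_n u n)%C)) H3.
rewrite /= Rplus_0_l; apply=> p.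
have -> : (l - sum_n u n)%C
  = (- (sum_n u (p + n) - l) + (sum_n u (p + n) - sum_n u n))%C by ring.
apply: Rle_trans (Cmod_triangle _ _) _.
by rewrite Cmod_opp; move: (Hd p); rewrite (Nat.add_comm n p); lra.
Qed.

Lemma Cseries_bound (u : nat -> C) (v : nat -> R) (l : C) (L : R) :
  (forall k, Cmod (u k) <= v k) -> is_series u l -> is_series v L ->
  Cmod l <= L.
Proof.
move=> Huv Hu Hv.
move: (Cseries_tail_bound u v l L 0 Huv Hu Hv) (Huv O); rewrite !sum_O => H1 H2.
have -> : l = ((l - u O) + u O)%C by ring.
by move: (Cmod_triangle (l - u O)%C (u O)); lra.
Qed.

Lemma Cseries_terms_bounded (u : nat -> C) (l : C) :
  is_series u l -> exists M, forall k, Cmod (u k) <= M.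
Proof.
move=> H.
have [M HM] : {M : R | forall n, norm (V := C_NormedModule) (sum_n u n) <= M}.
  by apply: filterlim_bounded; exists l.
exists (M + M) => -[|k].
  have H0 : Cmod (sum_n u O) <= M := HM O.
  rewrite sum_O in H0.
  by move: (Cmod_ge_0 (u O)); lra.
have -> : u (S k) = (sum_n u (S k) + - sum_n u k)%C by rewrite sum_n_S; ring.
apply: Rle_trans (Cmod_triangle _ _) _; rewrite Cmod_opp.
exact: Rplus_le_compat (HM (S k)) (HM k).
Qed.

Lemma ex_series_of_bounded_terms (b : nat -> R) (M r s : R) :
  0 <= r < s -> (forall k, 0 <= b k) -> (forall k, b k * s ^ k <= M) ->
  ex_series (fun k => b k * r ^ k).
Proof.
move=> Hr Hb HM.
apply: (ex_series_le (V := R_CompleteNormedModule) _ (fun k => M * (r / s) ^ k)).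
  move=> k; rewrite /norm /= /abs /= Rabs_pos_eq; last first.
    by apply: Rmult_le_pos (Hb k) _; apply: pow_le; lra.
  have -> : b k * r ^ k = (b k * s ^ k) * (r / s) ^ k.
    rewrite Rmult_assoc -Rpow_mult_distr.
    by have -> : s * (r / s) = r by field; lra.
  apply: Rmult_le_compat_r (HM k); apply: pow_le.
  by apply: Rdiv_le_0_compat; lra.
apply: (ex_series_scal_l M (fun k => (r / s) ^ k)).
apply: ex_series_geom.
rewrite Rabs_pos_eq; last by apply: Rdiv_le_0_compat; lra.
by apply/Rlt_div_l; lra.
Qed.

Lemma bounded_partial_sums (u : nat -> R) (M : R) :
  (forall k, 0 <= u k) -> (forall n, sum_n u n <= M) ->
  ex_series u /\ Series u <= M.
Proof.
move=> Hu HM.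
have [l Hl] : ex_finite_lim_seq (sum_n u).
  apply: (ex_finite_lim_seq_incr _ M) => // n.
  by rewrite sum_n_SR; have := Hu (S n); lra.
split; first by exists l.
rewrite (is_series_unique u l Hl).
exact: (is_lim_seq_le _ _ l M HM Hl (is_lim_seq_const M)).
Qed.

(** * Power series on a disk *)

(** The expansion is written in terms of the displacement [h], so that an expansion
    of [f] at [w] is [represents a r (fun h => f (w + h))]. *)
Definition represents (a : nat -> C) (r : R) (F : C -> C) : Prop :=
  forall h : C, Cmod h < r -> is_series (fun k => (a k * h ^ k)%C) (F h).

Lemma represents_sub (a : nat -> C) (r s : R) (F : C -> C) :
  s <= r -> represents a r F -> represents a s F.
Proof. by move=> Hs H h Hh; apply: H; lra. Qed.

Lemma represents_ext (a b : nat -> C) (r : R) (F G : C -> C) :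
  (forall k, a k = b k) -> (forall h, Cmod h < r -> F h = G h) ->
  represents a r F -> represents b r G.
Proof.
move=> Hab HFG H h Hh; rewrite -HFG //.
by apply: Cseries_ext (H h Hh) => k; rewrite Hab.
Qed.

Lemma represents_abs (a : nat -> C) (R0 r : R) (F : C -> C) :
  represents a R0 F -> 0 <= r < R0 ->
  ex_series (fun k => Cmod (a k) * r ^ k).
Proof.
move=> H Hr; set s := (r + R0) / 2.
have Hs : 0 <= s by rewrite /s; lra.
have [|M HM] := Cseries_terms_bounded _ _ (H (RtoC s) _).
  by rewrite Cmod_RtoC_pos // /s; lra.
apply: (ex_series_of_bounded_terms _ M r s) => [|k|k]; first by rewrite /s; lra.
  exact: Cmod_ge_0.
by have := HM k; rewrite Cmod_mult Cmod_pow Cmod_RtoC_pos.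
Qed.

Definition monomial (n : nat) (c : C) : nat -> C :=
  fun k => if Nat.eqb k n then c else RtoC 0.

(** Together with [Cseries_unique], this evaluates the series having a single
    nonzero term. *)
Lemma represents_monomial (n : nat) (c : C) (r : R) :
  represents (monomial n c) r (fun z => (c * z ^ n)%C).
Proof.
move=> z _; apply/is_series_C_iff.
apply/(is_lim_seq_incr_n _ n).
apply: (is_lim_seq_ext (fun _ => 0)); last exact: is_lim_seq_const.
move=> p; rewrite -[LHS]Cmod_0; congr Cmod.
suff -> : sum_n (fun k => (monomial n c k * z ^ k)%C) (p + n) = (c * z ^ n)%C :> C by ring.
have Hlow q : (q < n)%nat -> sum_n (fun k => (monomial n c k * z ^ k)%C) q = RtoC 0 :> C.
  move=> Hq; rewrite -(sum_n_Czero q); apply: sum_n_Cext => k Hk.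
  rewrite /monomial; case: Nat.eqb_spec => [|_]; [lia | ring].
have Hn : sum_n (fun k => (monomial n c k * z ^ k)%C) n = (c * z ^ n)%C :> C.
  case: n Hlow => [|n] Hlow; first by rewrite sum_O /monomial.
  rewrite sum_n_S Hlow; last by lia.
  by rewrite /monomial Nat.eqb_refl; ring.
elim: p => [|p IH]; first exact: Hn.
rewrite Nat.add_succ_l sum_n_S IH /monomial; case: Nat.eqb_spec => [|_]; first by lia.
by ring.
Qed.

Lemma represents_at_0 (a : nat -> C) (r : R) (F : C -> C) :
  represents a r F -> 0 < r -> F (RtoC 0) = a O.
Proof.
move=> H Hr.
have H0 : Cmod (RtoC 0) < r by rewrite Cmod_0.
apply: (Cseries_unique _ _ _ (H _ H0)).
have := represents_monomial O (a O) r (RtoC 0) H0.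
rewrite [(RtoC 0 ^ 0)%C]/= Cmult_1_r; apply: Cseries_ext => -[|k] //.
by rewrite /monomial /=; ring.
Qed.

(** * Parseval's identity over the roots of unity *)

Lemma geometric_sum_C (q : C) (n : nat) :
  ((q - 1) * sum_n (fun j => q ^ j) n = q ^ (S n) - 1)%C.
Proof.
elim: n => [|n IH]; first by rewrite sum_O /=; ring.
by rewrite sum_n_S Cmult_plus_distr_l IH !Cpow_S; ring.
Qed.

(** The order is [S n], the number of terms of a sum indexed up to [n]. *)
Definition primitive_root (n : nat) (u : C) : Prop :=
  Cmod u = 1 /\ (u ^ S n)%C = RtoC 1 /\
  forall d, (0 < d <= n)%nat -> (u ^ d)%C <> RtoC 1.

Lemma primitive_root_exists (n : nat) : exists u, primitive_root n u.
Proof.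
have Hn : 0 < INR (S n) by apply: lt_0_INR; lia.
set t := 2 * PI / INR (S n).
have Hpow d : ((cos t, sin t) ^ d)%C = (cos (INR d * t), sin (INR d * t)).
  elim: d => [|d IH]; first by rewrite /= Rmult_0_l cos_0 sin_0.
  rewrite Cpow_S IH S_INR Rmult_plus_distr_r Rmult_1_l cos_plus sin_plus.
  by rewrite /Cmult /=; congr pair; ring.
exists (cos t, sin t); split; last split.
- rewrite /Cmod /= !Rmult_1_r -[X in sqrt X](Rplus_comm (sin t * sin t)).
  by rewrite -!/(Rsqr _) sin2_cos2 sqrt_1.
- rewrite Hpow; have -> : INR (S n) * t = 2 * PI by rewrite /t; field; lra.
  by rewrite cos_2PI sin_2PI.
- move=> d Hd; rewrite Hpow => -[Hc _].
  have Hd0 : 0 < INR d by apply: lt_0_INR; lia.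
  have Hd1 : INR d < INR (S n) by apply: lt_INR; lia.
  have Hpi := PI_RGT_0.
  (* [u ^ d = 1] would make the sine of the half angle vanish, but that angle lies
     strictly between 0 and [PI]. *)
  have Hh : INR d * t = 2 * (INR d / INR (S n) * PI) by rewrite /t; field; lra.
  have Hq0 : 0 < INR d / INR (S n) by apply: Rdiv_lt_0_compat.
  have Hq1 : INR d / INR (S n) < 1 by apply/Rlt_div_l; lra.
  move: Hc; rewrite Hh cos_2a_sin.
  have := sin_gt_0 (INR d / INR (S n) * PI) ltac:(nra) ltac:(nra).
  by nra.
Qed.

Lemma Cmod2_plus (x y : C) :
  Cmod (x + y)%C ^ 2 = Cmod x ^ 2 + Cmod y ^ 2 + 2 * Re (Cconj x * y)%C.
Proof. by rewrite !Cmod2_alt; case: x y => [a b] [c d] /=; ring. Qed.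

(** The terms are the powers of [u ^ (l - k)], which is not 1 because
    [0 < l - k < S n], so the geometric sum vanishes. *)
Lemma primitive_root_orthogonal (n k l : nat) (u : C) :
  primitive_root n u -> (k < l <= n)%nat ->
  sum_n (fun j => (Cconj ((u ^ j) ^ k) * (u ^ j) ^ l)%C) n = RtoC 0.
Proof.
move=> [Hu1 [HuN Hud]] Hkl.
rewrite (sum_n_ext _ (fun j => ((u ^ (l - k)) ^ j)%C)); last first.
  move=> j; have {1}-> : l = (k + (l - k))%nat by lia.
  rewrite Cpow_add_r Cmult_assoc [X in (X * _)%C]Cmult_comm -Cmod2_conj.
  rewrite !Cmod_pow Hu1 !pow1 Cmult_1_l -!Cpow_mult_r.
  by rewrite Nat.mul_comm.
have := geometric_sum_C (u ^ (l - k))%C n.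
rewrite -Cpow_mult_r Nat.mul_comm Cpow_mult_r HuN Cpow_1_l.
have -> : (1 - 1)%C = RtoC 0 by ring.
move=> H; have Hne := Hud (l - k)%nat ltac:(lia).
have Hne' : (u ^ (l - k) - 1)%C <> RtoC 0.
  move=> H0; apply: Hne.
  have -> : (u ^ (l - k))%C = ((u ^ (l - k) - 1) + 1)%C by ring.
  by rewrite H0; ring.
by apply: NNPP => Hs; case: (Cmult_neq_0 _ _ Hne' Hs).
Qed.

(** The number [S n] of points exceeds the degree [m], so that the monomials up to
    degree [m] are orthogonal for the average over the roots of unity.  The
    induction adds one monomial at a time; the cross term vanishes. *)
Lemma parseval_roots_of_unity (n m : nat) (u : C) (c : nat -> C) :
  primitive_root n u -> (m <= n)%nat ->
  sum_n (fun j => Cmod (sum_n (fun k => (c k * (u ^ j) ^ k)%C) m) ^ 2) n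
  = INR (S n) * sum_n (fun k => Cmod (c k) ^ 2) m.
Proof.
move=> Hu.
have Hmod (j k : nat) (x : C) : Cmod (x * (u ^ j) ^ k)%C = Cmod x.
  by rewrite Cmod_mult !Cmod_pow (proj1 Hu) !pow1 Rmult_1_r.
elim: m => [|m IH] Hm.
  rewrite sum_O -sum_n_Rconst; apply: sum_n_ext => j.
  by rewrite sum_O Hmod.
rewrite (sum_n_ext _ (fun j =>
  (Cmod (sum_n (fun k => (c k * (u ^ j) ^ k)%C) m) ^ 2 + Cmod (c (S m)) ^ 2)
  + 2 * Re (Cconj (sum_n (fun k => (c k * (u ^ j) ^ k)%C) m)
            * (c (S m) * (u ^ j) ^ (S m)))%C)); last first.
  by move=> j; rewrite sum_n_S Cmod2_plus Hmod.
rewrite !sum_n_Rplus sum_n_Rscal sum_n_Rconst IH; last by lia.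
rewrite sum_n_SR -sum_n_Re.
suff -> : sum_n (fun j =>
    (Cconj (sum_n (fun k => (c k * (u ^ j) ^ k)%C) m)
     * (c (S m) * (u ^ j) ^ (S m)))%C) n = RtoC 0.
  have Hr (x y z : R) : x * y + x * z + 2 * 0 = x * (y + z) by ring.
  exact: Hr.
rewrite (sum_n_ext _ (fun j => sum_n (fun k =>
  (Cconj (c k) * c (S m) * (Cconj ((u ^ j) ^ k) * (u ^ j) ^ (S m)))%C) m)); last first.
  move=> j; rewrite sum_n_Cconj Cmult_comm -sum_n_Cscal.
  by apply: sum_n_Cext => k _; rewrite Cmult_conj; ring.
rewrite sum_n_switch.
rewrite -(sum_n_Czero m); apply: sum_n_Cext => k Hk.
rewrite sum_n_Cscal (primitive_root_orthogonal n k (S m) u Hu) //; last by lia.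
by ring.
Qed.

(** * Bessel's inequality and its consequences *)

Lemma represents_minus (a b : nat -> C) (r : R) (F G : C -> C) :
  represents a r F -> represents b r G ->
  represents (fun k => a k - b k)%C r (fun h => F h - G h)%C.
Proof.
move=> Ha Hb h Hh.
apply: Cseries_ext (Cseries_minus _ _ _ _ (Ha h Hh) (Hb h Hh)) => k /=.
by ring.
Qed.

(** The partial sum of order [n] differs from [F] on the circle by at most the
    remainder of [sum_k |a_k| r^k].  Parseval's identity for it therefore bounds
    the sum of squares by [(M + remainder)^2], and the remainder tends to zero. *)
Lemma bessel_circle (a : nat -> C) (R0 r M : R) (F : C -> C) (m : nat) :
  represents a R0 F -> 0 <= r < R0 -> 0 <= M ->
  (forall h, Cmod h = r -> Cmod (F h) <= M) ->
  sum_n (fun k => (Cmod (a k) * r ^ k) ^ 2) m <= M ^ 2.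
Proof.
move=> H Hr HM HF.
set b := fun k => Cmod (a k) * r ^ k.
have [L HL] : ex_series b := represents_abs a R0 r F H Hr.
have Hstep n : (m <= n)%nat ->
    sum_n (fun k => b k ^ 2) m <= (M + (L - sum_n b n)) ^ 2.
  move=> Hmn.
  have [u Hu] := primitive_root_exists n.
  have Hval j : Cmod (sum_n (fun k => (a k * r ^ k * (u ^ j) ^ k)%C) n)
      <= M + (L - sum_n b n).
    set z := (RtoC r * u ^ j)%C.
    have Hz : Cmod z = r.
      by rewrite /z Cmod_mult Cmod_pow (proj1 Hu) pow1 Rmult_1_r Cmod_RtoC_pos; lra.
    have Hser := H z ltac:(lra).
    have := Cseries_tail_bound _ b _ L n _ Hser HL.
    rewrite (sum_n_Cext _ (fun k => (a k * r ^ k * (u ^ j) ^ k)%C)); last first.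
      by move=> k _; rewrite /z Cpow_mult_l; ring.
    set S : C := sum_n _ n => Ht.
    have -> : S = (F z + - (F z - S))%C by ring.
    apply: Rle_trans (Cmod_triangle _ _) _; rewrite Cmod_opp.
    apply: Rplus_le_compat (HF z Hz) (Ht _) => k.
    by rewrite Cmod_mult Cmod_pow Hz; apply: Rle_refl.
  have := parseval_roots_of_unity n n u (fun k => (a k * r ^ k)%C) Hu (le_n _).
  rewrite (sum_n_ext (fun k => Cmod (a k * r ^ k)%C ^ 2) (fun k => b k ^ 2)); last first.
    by move=> k; rewrite /b Cmod_mult Cmod_pow Cmod_RtoC_pos //; lra.
  move=> Hpars.
  have Hn : 0 < INR (S n) by apply: lt_0_INR; lia.
  have Hmono : sum_n (fun k => b k ^ 2) m <= sum_n (fun k => b k ^ 2) n.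
    elim: (n) Hmn => [|p IH] Hp; first by have -> : m = O by [lia]; apply: Rle_refl.
    case: (Nat.eq_dec m (S p)) => [->|Hne]; first exact: Rle_refl.
    rewrite sum_n_SR; move: (IH ltac:(lia)) (pow2_ge_0 (b (S p))); lra.
  apply: Rle_trans Hmono _.
  apply: (Rmult_le_reg_l (INR (S n))) => //.
  rewrite -Hpars -sum_n_Rconst; apply: sum_n_le => j _.
  apply: pow_incr; split; [exact: Cmod_ge_0 | exact: Hval].
have Hlim : is_lim_seq (fun n => (M + (L - sum_n b (n + m))) ^ 2) (M ^ 2).
  have H1 : is_lim_seq (fun n => sum_n b (n + m)) L.
    by apply/(is_lim_seq_incr_n (sum_n b)).
  have H2 := is_lim_seq_plus' _ _ _ _ (is_lim_seq_const M)
    (is_lim_seq_minus' _ _ _ _ (is_lim_seq_const L) H1).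
  have := is_lim_seq_mult' _ _ _ _ H2 H2.
  have -> : (M + (L - L)) * (M + (L - L)) = M ^ 2 by ring.
  by apply: is_lim_seq_ext => n; ring.
have := is_lim_seq_le _ _ _ _ _ (is_lim_seq_const _) Hlim.
by apply=> n; apply: Hstep; lia.
Qed.

Lemma le_of_le_left (phi : R -> R) (x c : R) :
  0 < x -> continuity_pt phi x -> (forall r, 0 <= r < x -> phi r <= c) ->
  phi x <= c.
Proof.
move=> Hx Hc H; apply: Rnot_lt_le => Hlt.
have [al [Hal Hphi]] := Hc (phi x - c) ltac:(lra).
set r := x - Rmin (al / 2) (x / 2).
have Hm : 0 < Rmin (al / 2) (x / 2) by apply: Rmin_pos; lra.
have Hm1 := Rmin_l (al / 2) (x / 2); have Hm2 := Rmin_r (al / 2) (x / 2).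
have Hr : 0 <= r < x by rewrite /r; lra.
have := Hphi r; rewrite /D_x /no_cond /dist /= /Rdist => Hp.
have {Hp}: Rabs (phi r - phi x) < phi x - c.
  apply: Hp; split; first by split=> //; lra.
  by rewrite Rabs_left1 /r; lra.
by move/Rabs_def2 => [_]; move: (H r Hr); lra.
Qed.

Lemma bessel_disk (a : nat -> C) (r M : R) (F : C -> C) (m : nat) :
  represents a r F -> 0 < r -> 0 <= M ->
  (forall h, Cmod h < r -> Cmod (F h) <= M) ->
  sum_n (fun k => (Cmod (a k) * r ^ k) ^ 2) m <= M ^ 2.
Proof.
move=> H Hr HM HF.
apply: (le_of_le_left (fun s => sum_n (fun k => (Cmod (a k) * s ^ k) ^ 2) m)) => //.
  elim: m => [|m IH].
    apply: (continuity_pt_ext (fun s => (Cmod (a O) * s ^ O) ^ 2)).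
      by move=> s; rewrite sum_O.
    by apply: derivable_continuous_pt; reg.
  apply: (continuity_pt_ext (fun s => sum_n (fun k => (Cmod (a k) * s ^ k) ^ 2) m
      + (Cmod (a (S m)) * s ^ (S m)) ^ 2)).
    by move=> s; rewrite sum_n_SR.
  apply: continuity_pt_plus => //.
  by apply: derivable_continuous_pt; reg.
move=> s Hs; apply: (bessel_circle a r s M F) => // h Hh.
by apply: HF; lra.
Qed.

Lemma cauchy_estimate (a : nat -> C) (r M : R) (F : C -> C) (k : nat) :
  represents a r F -> 0 < r -> 0 <= M ->
  (forall h, Cmod h < r -> Cmod (F h) <= M) ->
  Cmod (a k) * r ^ k <= M.
Proof.
move=> H Hr HM HF.
have := bessel_disk a r M F k H Hr HM HF.
have := term_le_sum_n (fun k => (Cmod (a k) * r ^ k) ^ 2) k k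
  (fun j => pow2_ge_0 _) (le_n _).
have : 0 <= Cmod (a k) * r ^ k.
  by apply: Rmult_le_pos; [exact: Cmod_ge_0 | apply: pow_le; lra].
by nra.
Qed.

(** Cauchy's estimate for the difference, which represents zero, with [M = 0]. *)
Lemma represents_unique (a b : nat -> C) (r : R) (F : C -> C) (k : nat) :
  0 < r -> represents a r F -> represents b r F -> a k = b k.
Proof.
move=> Hr Ha Hb.
have := cauchy_estimate _ r 0 _ k (represents_minus _ _ _ _ _ Ha Hb) Hr (Rle_refl _).
case=> [h _||H0].
- have -> : (F h - F h)%C = RtoC 0 by ring.
  by rewrite Cmod_0; apply: Rle_refl.
- have Hp := pow_lt r k Hr.
  have := Cmod_ge_0 (a k - b k)%C; nra.
have Hp := pow_lt r k Hr.
have /Cmod_eq_0 Hz : Cmod (a k - b k)%C = 0 by have := Cmod_ge_0 (a k - b k)%C; nra.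
have -> : a k = ((a k - b k) + b k)%C by ring.
by rewrite Hz; ring.
Qed.

(** * Re-expansion of a power series at another centre *)

Lemma binom_SS (m k : nat) :
  binom (S m) (S k) = (binom m (S k) + binom m k)%nat.
Proof. exact: binomial.binS. Qed.

Lemma binom_small (m k : nat) : (m < k)%nat -> binom m k = O.
Proof. by move=> H; apply: binomial.bin_small; apply: (ssrbool.introT ssrnat.ltP). Qed.

Definition binomial_term (w h : C) (m k : nat) : C :=
  (INR (binom m k) * w ^ (m - k) * h ^ k)%C.

Lemma binomial_term_SS (w h : C) (m k : nat) :
  binomial_term w h (S m) (S k)
  = (w * binomial_term w h m (S k) + h * binomial_term w h m k)%C.
Proof.
rewrite /binomial_term binom_SS plus_INR RtoC_plus Nat.sub_succ Cpow_S.
case: (Nat.lt_ge_cases k m) => Hk.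
  have -> : (m - k)%nat = S (m - S k) by lia.
  by rewrite Cpow_S; ring.
by rewrite (binom_small m (S k)) /=; [ring | lia].
Qed.

Lemma binomial_term_S0 (w h : C) (m : nat) :
  binomial_term w h (S m) 0 = (w * binomial_term w h m 0)%C.
Proof. by rewrite /binomial_term !binomial.bin0 !Nat.sub_0_r Cpow_S; ring. Qed.

Definition binomial_partial (w h : C) (m n : nat) : C :=
  sum_n (binomial_term w h m) n.

Lemma binomial_partial_SS (w h : C) (m n : nat) :
  binomial_partial w h (S m) (S n)
  = (w * binomial_partial w h m (S n) + h * binomial_partial w h m n)%C.
Proof.
rewrite /binomial_partial; elim: n => [|n IH].
  by rewrite !sum_n_S !sum_O binomial_term_S0 binomial_term_SS; ring.
rewrite sum_n_S IH binomial_term_SS.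
by rewrite (sum_n_S (binomial_term w h m) (S n)) (sum_n_S (binomial_term w h m) n); ring.
Qed.

Lemma binomial_partial_S0 (w h : C) (m : nat) :
  binomial_partial w h (S m) 0 = (w * binomial_partial w h m 0)%C.
Proof. by rewrite /binomial_partial !sum_O binomial_term_S0. Qed.

Lemma binomial_partial_0 (w h : C) (n : nat) :
  binomial_partial w h 0 n = RtoC 1.
Proof.
rewrite /binomial_partial; elim: n => [|n IH].
  by rewrite sum_O /binomial_term /=; ring.
by rewrite sum_n_S IH /binomial_term (binom_small 0 (S n)) /=; [ring | lia].
Qed.

Lemma binomial_formula_C (w h : C) (m n : nat) :
  (m <= n)%nat -> binomial_partial w h m n = ((w + h) ^ m)%C.
Proof.
elim: m n => [|m IH] n Hn; first by rewrite binomial_partial_0.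
case: n Hn => [|n] Hn; first by lia.
rewrite binomial_partial_SS !IH; try lia.
by rewrite Cpow_S; ring.
Qed.

(** A truncated binomial expansion controls the re-expansion of a power series
    without exchanging two infinite sums: the factor [t ^ S n] does not depend on
    [m] and tends to zero with [n], while [(Cmod w + y) ^ m] is summable against
    the coefficients as long as [Cmod w + y] is less than the radius.  The
    induction on [m] is Pascal's rule for the truncated expansions. *)
Lemma binomial_remainder_bound (w h : C) (y t : R) (m n : nat) :
  0 <= y -> 0 <= t <= 1 -> Cmod h <= t * y ->
  Cmod ((w + h) ^ m - binomial_partial w h m n)%C
  <= t ^ (S n) * (Cmod w + y) ^ m.
Proof.
move=> Hy Ht Hh; have Hw := Cmod_ge_0 w; have Hh0 := Cmod_ge_0 h.
have Hwh p : Cmod ((w + h) ^ p)%C <= (Cmod w + y) ^ p.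
  rewrite Cmod_pow; apply: pow_incr; split; first exact: Cmod_ge_0.
  by move: (Cmod_triangle w h); nra.
have HL p : 0 <= (Cmod w + y) ^ p by apply: pow_le; lra.
have Hstep (x1 x2 : C) (b p : R) : 0 <= p -> Cmod x1 <= t * b * p ->
    Cmod x2 <= b * p -> Cmod (w * x1 + h * x2)%C <= t * b * ((Cmod w + y) * p).
  move=> Hp H1 H2; apply: Rle_trans (Cmod_triangle _ _) _.
  rewrite !Cmod_mult.
  have := Rmult_le_compat_l _ _ _ Hw H1.
  have := Rmult_le_compat _ _ _ _ Hh0 (Cmod_ge_0 x2) Hh H2.
  by lra.
elim: m n => [|m IH] n.
  rewrite binomial_partial_0 /=.
  have -> : (1 - 1)%C = RtoC 0 by ring.
  rewrite Cmod_0; have := pow_le t n; nra.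
case: n => [|n].
  rewrite binomial_partial_S0 Cpow_S.
  have -> : ((w + h) * (w + h) ^ m - w * binomial_partial w h m 0)%C
    = (w * ((w + h) ^ m - binomial_partial w h m 0) + h * (w + h) ^ m)%C by ring.
  apply: (Hstep _ _ (t ^ O) ((Cmod w + y) ^ m)) => //.
  by have := Hwh m; rewrite /=; lra.
rewrite binomial_partial_SS Cpow_S.
have -> : ((w + h) * (w + h) ^ m
    - (w * binomial_partial w h m (S n) + h * binomial_partial w h m n))%C
  = (w * ((w + h) ^ m - binomial_partial w h m (S n))
    + h * ((w + h) ^ m - binomial_partial w h m n))%C by ring.
apply: (Hstep _ _ (t ^ S n) ((Cmod w + y) ^ m)) => //.
Qed.

Lemma binom_le_pow (x y : R) (m k : nat) :
  0 <= x -> 0 <= y -> INR (binom m k) * x ^ (m - k) * y ^ k <= (x + y) ^ m.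
Proof.
move=> Hx Hy; elim: m k => [|m IH] [|k].
- by rewrite /=; lra.
- by rewrite (binom_small 0 (S k)) /=; [lra | lia].
- rewrite binomial.bin0 Nat.sub_0_r /= !Rmult_1_r Rmult_1_l.
  have := IH O; rewrite binomial.bin0 Nat.sub_0_r /= !Rmult_1_r Rmult_1_l => H.
  have := pow_le x m Hx.
  by nra.
rewrite binom_SS plus_INR Nat.sub_succ -(tech_pow_Rmult _ m) -(tech_pow_Rmult _ k).
have H1 := Rmult_le_compat_l _ _ _ Hy (IH k).
have H2 := Rmult_le_compat_l _ _ _ Hx (IH (S k)).
rewrite -(tech_pow_Rmult _ k) in H2.
case: (Nat.lt_ge_cases k m) => Hk.
  have Hmk : (m - k)%nat = S (m - S k) by lia.
  by rewrite Hmk -(tech_pow_Rmult _ (m - S k)) in H1 *; lra.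
rewrite (binom_small m (S k)) in H2 *; [|lia..].
rewrite /= in H2 *; lra.
Qed.

(** The [k]-th Taylor coefficient at [w] of the sum of the power series [a]. *)
Definition taylor_coef (a : nat -> C) (w : C) (k : nat) : C :=
  csum (fun m => (a m * (INR (binom m k) * w ^ (m - k)))%C).

Lemma taylor_coef_correct (a : nat -> C) (r : R) (F : C -> C) (w : C) (k : nat) :
  represents a r F -> Cmod w < r ->
  is_series (fun m => (a m * (INR (binom m k) * w ^ (m - k)))%C)
    (taylor_coef a w k).
Proof.
move=> H Hw; apply: csum_correct.
have Hw0 := Cmod_ge_0 w.
set s := (r - Cmod w) / 2; have Hs : 0 < s by rewrite /s; lra.
have Hsk := pow_lt s k Hs.
have Habs : ex_series (fun m => Cmod (a m) * (Cmod w + s) ^ m).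
  by apply: (represents_abs a r _ F H); rewrite /s; lra.
apply: (ex_series_le (V := R_CompleteNormedModule) _
  (fun m => / s ^ k * (Cmod (a m) * (Cmod w + s) ^ m))); last first.
  exact: (ex_series_scal_l (/ s ^ k) _ Habs).
move=> m; rewrite /norm /= /abs /= Rabs_pos_eq; last exact: Cmod_ge_0.
rewrite !Cmod_mult Cmod_pow Cmod_RtoC_pos; last exact: pos_INR.
apply: (Rmult_le_reg_l (s ^ k)) => //.
rewrite -(Rmult_assoc (s ^ k) (/ s ^ k)) Rinv_r; last by lra.
rewrite Rmult_1_l.
have := Rmult_le_compat_l _ _ _ (Cmod_ge_0 (a m))
  (binom_le_pow (Cmod w) s m k Hw0 (Rlt_le _ _ Hs)).
by lra.
Qed.

(** For fixed [n], the partial sum of order [n] of the new series is the sum over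
    [m] of [a m] times the binomial expansion of [(w + h) ^ m] truncated at [n],
    so [binomial_remainder_bound] bounds its distance to [F (w + h)] by a
    constant times [t ^ S n] with [t < 1]. *)
Lemma represents_recenter (a : nat -> C) (r : R) (F : C -> C) (w : C) :
  represents a r F -> Cmod w < r ->
  represents (taylor_coef a w) (r - Cmod w) (fun h => F (w + h)%C).
Proof.
move=> H Hw h Hh.
have Hw0 := Cmod_ge_0 w; have Hh0 := Cmod_ge_0 h.
(* With [Cmod h < y < r - Cmod w], the series [a] converges absolutely at
   [Cmod w + y], and the ratio [t] is less than 1. *)
set y := (Cmod h + (r - Cmod w)) / 2.
have Hy : Cmod h < y < r - Cmod w by rewrite /y; lra.
set t := Cmod h / y.
have Ht : 0 <= t < 1.
  split; first by apply: Rdiv_le_0_compat; lra.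
  by apply/Rlt_div_l; lra.
have Hty : Cmod h = t * y by rewrite /t; field; lra.
have [A HA] : ex_series (fun m => Cmod (a m) * (Cmod w + y) ^ m).
  by apply: (represents_abs a r _ F H); lra.
have Hwh : Cmod (w + h)%C < r by move: (Cmod_triangle w h); lra.
have Hrem n : Cmod (F (w + h)%C - sum_n (fun k => (taylor_coef a w k * h ^ k)%C) n)%C
    <= t ^ (S n) * A.
  have Hk k : is_series (fun m => (a m * binomial_term w h m k)%C)
      (taylor_coef a w k * h ^ k)%C.
    rewrite Cmult_comm.
    apply: Cseries_ext (Cseries_scal (h ^ k)%C _ _ (taylor_coef_correct a r F w k H Hw)) => m.
    by rewrite /binomial_term; ring.
  have Hd := Cseries_minus _ _ _ _ (H _ Hwh) (Cseries_sum_n _ _ n Hk).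
  apply: (Cseries_bound _ _ _ _ _ Hd (is_series_scal_l (t ^ (S n)) _ _ HA)) => m.
  rewrite sum_n_Cscal.
  change (sum_n (fun k => binomial_term w h m k) n) with (binomial_partial w h m n).
  have -> : (a m * (w + h) ^ m - a m * binomial_partial w h m n)%C
    = (a m * ((w + h) ^ m - binomial_partial w h m n))%C by ring.
  rewrite Cmod_mult.
  have Hb := binomial_remainder_bound w h y t m n ltac:(lra) ltac:(lra) ltac:(lra).
  have := Rmult_le_compat_l _ _ _ (Cmod_ge_0 (a m)) Hb.
  change (scal (t ^ S n) (Cmod (a m) * (Cmod w + y) ^ m))
    with (t ^ S n * (Cmod (a m) * (Cmod w + y) ^ m)).
  by lra.
apply/is_series_C_iff.
have Hgeo : is_lim_seq (fun n => t ^ (S n) * A) 0.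
  have := is_lim_seq_mult' _ _ _ _
    (proj1 (is_lim_seq_incr_1 _ _) (is_lim_seq_geom t _)) (is_lim_seq_const A).
  by rewrite Rmult_0_l; apply; rewrite Rabs_pos_eq; lra.
apply: (is_lim_seq_le_le (fun _ => 0) _ _ _ _ (is_lim_seq_const 0) Hgeo) => n.
split; first exact: Cmod_ge_0.
by rewrite -Cmod_opp Copp_minus_distr; apply: Hrem.
Qed.

(** As a function of the centre, the [k]-th Taylor coefficient is [1/k!] times the
    [k]-th derivative, again a power series with the same radius.  Cauchy's
    estimates can thus be applied to it. *)
Lemma represents_taylor_coef (a : nat -> C) (r : R) (F : C -> C) (k : nat) :
  represents a r F ->
  represents (fun i => (a (k + i)%nat * INR (binom (k + i) k))%C) r
    (fun w => taylor_coef a w k).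
Proof.
move=> H w Hw.
have Hser := taylor_coef_correct a r F w k H Hw.
case: k Hser => [|k] Hser.
  by apply: Cseries_ext Hser => m; rewrite Nat.sub_0_r /=; ring.
have H0 : sum_n (fun m => (a m * (INR (binom m (S k)) * w ^ (m - S k)))%C) k = RtoC 0.
  rewrite -(sum_n_Czero k); apply: sum_n_Cext => j Hj.
  by rewrite (binom_small j (S k)) /=; [ring | lia].
have := is_series_incr_n (V := C_NormedModule)
  (fun m => (a m * (INR (binom m (S k)) * w ^ (m - S k)))%C) (S k)
  (taylor_coef a w (S k)) ltac:(lia).
rewrite [Init.Nat.pred _]/= H0 plus_zero_r => /(_ Hser).
apply: Cseries_ext => i.
have -> : (S k + i - S k)%nat = i by lia.
by ring.
Qed.

(** * Uniformity over a closed disk *)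

Lemma Cmod_le_abs_sum (z : C) : Cmod z <= Rabs (fst z) + Rabs (snd z).
Proof.
have H1 := Rabs_pos (fst z); have H2 := Rabs_pos (snd z).
rewrite /Cmod -[X in _ <= X]sqrt_pow2; last by lra.
apply: sqrt_le_1_alt.
by rewrite -(pow2_abs (fst z)) -(pow2_abs (snd z)); nra.
Qed.

(** Compactness of the closed disk for a property that is easier to satisfy with a
    smaller radius.  At centres outside the disk a radius that misses the disk
    makes the local hypothesis vacuous, so that the compactness of a square
    applies. *)
Lemma closed_disk_uniform (P : C -> R -> Prop) (rho : R) :
  (forall z d d', P z d -> 0 < d' <= d -> P z d') ->
  (forall w, Cmod w <= rho ->
     exists r, 0 < r /\ forall z, Cmod z <= rho -> Cmod (z - w)%C < r -> P z r) ->
  exists d, 0 < d /\ forall z, Cmod z <= rho -> P z d.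
Proof.
move=> Pmono Ploc.
have Hall (w : C) : exists r, 0 < r /\
    forall z, Cmod z <= rho -> Cmod (z - w)%C < r -> P z r.
  case: (Rle_lt_dec (Cmod w) rho) => Hw; first exact: Ploc.
  exists (Cmod w - rho); split; first by lra.
  move=> z Hz Hzw; exfalso.
  have := Cmod_triangle z (- (z - w))%C; rewrite Cmod_opp.
  have -> : (z + - (z - w))%C = w by ring.
  by lra.
set rad := fun w => proj1_sig (constructive_indefinite_description _ (Hall w)).
have Hrad w : 0 < rad w /\
    forall z, Cmod z <= rho -> Cmod (z - w)%C < rad w -> P z (rad w).
  exact: (proj2_sig (constructive_indefinite_description _ (Hall w))).
have Hhalf u v : 0 < rad (u, v) / 2 by have [] := Hrad (u, v); lra.
have [d Hd] := compactness_value_2d (- rho) rho (- rho) rho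
  (fun u v => mkposreal _ (Hhalf u v)).
exists d; split; first exact: cond_pos.
move=> z Hz.
have Hmax := Rmax_Cmod z.
have /Rabs_le_between Hx : Rabs (fst z) <= rho.
  by have := Rmax_l (Rabs (fst z)) (Rabs (snd z)); lra.
have /Rabs_le_between Hy : Rabs (snd z) <= rho.
  by have := Rmax_r (Rabs (fst z)) (Rabs (snd z)); lra.
have [u [v /= [_ [_ [Hu [Hv Huv]]]]]] := NNPP _ (Hd _ _ Hx Hy).
have [Hr0 HP] := Hrad (u, v).
apply: (Pmono z (rad (u, v))); last by have := cond_pos d; lra.
apply: HP => //.
have := Cmod_le_abs_sum (z - (u, v))%C; rewrite /= -!/(Rminus _ _); lra.
Qed.

(** * Analytic functions bounded by one on the unit disk *)

(** Cauchy's estimate for the Taylor coefficients as functions of the centre gives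
    [binom m k * |a m| * r ^ (m - k) * d ^ k <= 1].  Replacing [d] by [d / 2]
    gains a factor [2 ^ -k], and the binomial formula sums these bounds over [k].
    The radius of convergence is thus at least [r + d / 2]. *)
Lemma coefficient_bound_past_radius (a : nat -> C) (r d : R) (F : C -> C) (m : nat) :
  represents a r F -> 0 < r -> 0 < d ->
  (forall w k, Cmod w < r -> Cmod (taylor_coef a w k) * d ^ k <= 1) ->
  Cmod (a m) * (r + d / 2) ^ m <= 2.
Proof.
move=> H Hr Hd Hbound.
have Hterm k : (k <= m)%nat ->
    Cmod (a m * binomial_term (RtoC r) (RtoC (d / 2)) m k)%C <= (1 / 2) ^ k.
  move=> Hk; have Hdk := pow_lt d k Hd.
  have Hc := cauchy_estimate _ r (/ d ^ k) _ (m - k) (represents_taylor_coef a r F k H) Hr.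
  have Hm : (k + (m - k))%nat = m by lia.
  rewrite Hm in Hc.
  have {}Hc : Cmod (a m * INR (binom m k))%C * r ^ (m - k) <= / d ^ k.
    apply: Hc; first by apply: Rlt_le; apply: Rinv_0_lt_compat.
    move=> w Hw; apply: (Rmult_le_reg_r (d ^ k)) => //.
    by rewrite Rinv_l; [apply: Hbound | lra].
  rewrite /binomial_term !Cmod_mult !Cmod_pow !Cmod_RtoC_pos; try lra; last exact: pos_INR.
  rewrite Cmod_mult Cmod_RtoC_pos in Hc; last exact: pos_INR.
  have Hh : 0 < (1 / 2) ^ k by apply: pow_lt; lra.
  have -> : d / 2 = d * (1 / 2) by field.
  rewrite Rpow_mult_distr.
  have := Rmult_le_compat_r (d ^ k * (1 / 2) ^ k) _ _ ltac:(nra) Hc.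
  have -> : / d ^ k * (d ^ k * (1 / 2) ^ k) = (1 / 2) ^ k by field; lra.
  by lra.
have Hgeo n : sum_n (fun k => (1 / 2) ^ k) n <= 2.
  suff -> : sum_n (fun k => (1 / 2) ^ k) n = 2 - (1 / 2) ^ n.
    by have := pow_lt (1 / 2) n ltac:(lra); lra.
  elim: n => [|n IH]; first by rewrite sum_O /=; lra.
  by rewrite sum_n_SR IH /=; lra.
have Hr0 : 0 <= r + d / 2 by lra.
rewrite -{1}(Cmod_RtoC_pos _ Hr0) -Cmod_pow -Cmod_mult RtoC_plus.
rewrite -(binomial_formula_C _ _ m m (le_n _)) /binomial_partial -sum_n_Cscal.
apply: Rle_trans (Cmod_sum_n _ _) _.
apply: Rle_trans (Hgeo m).
by apply: sum_n_le => k Hk; apply: Hterm.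
Qed.

Lemma pow_n_Cpow (z : C) (k : nat) : pow_n z k = (z ^ k)%C.
Proof. by elim: k => [//|k IH]; rewrite Cpow_S -IH. Qed.

Lemma analytic_represents (Omega : C -> Prop) (f : C -> C) (w : C) :
  analytic Omega f -> Omega w ->
  exists r b, 0 < r /\ represents b r (fun h => f (w + h)%C).
Proof.
move=> Hf Hw; have [r [b [Hr [_ Hb]]]] := Hf w Hw.
exists r, b; split=> // h Hh.
have Hwh : (w + h - w)%C = h by ring.
have := Hb (w + h)%C; rewrite /open_disk Hwh => /(_ Hh).
apply: Cseries_ext => k; rewrite pow_n_Cpow.
exact: Cmult_comm.
Qed.

(** The inequality keeps the disk of the expansion inside the unit disk, so that a
    bound on [f] there yields Cauchy's estimates. *)
Definition expands_at (f : C -> C) (z : C) (d : R) : Prop :=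
  Cmod z + d <= 1 /\ exists b, represents b d (fun h => f (z + h)%C).

(** An expansion at [w] of radius [r0] gives one of radius [r0 / 2] at each point
    within [r0 / 2] of [w]; cut down to stay in the unit disk,
    this is the local uniformity that compactness needs. *)
Lemma analytic_uniform_radius (f : C -> C) (rho : R) :
  analytic unit_disk f -> rho < 1 ->
  exists d, 0 < d /\ forall z, Cmod z <= rho -> expands_at f z d.
Proof.
move=> Hf Hrho; apply: closed_disk_uniform.
  move=> z d d' [H1 [b Hb]] Hd'; split; first by lra.
  by exists b; apply: represents_sub Hb; lra.
move=> w Hw.
have [r0 [b [Hr0 Hb]]] := analytic_represents _ f w Hf (Rle_lt_trans _ _ _ Hw Hrho).
set r := Rmin (r0 / 2) ((1 - Cmod w) / 2).
have Hr : 0 < r by apply: Rmin_pos; lra.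
have Hr1 : r <= r0 / 2 := Rmin_l _ _.
have Hr2 : r <= (1 - Cmod w) / 2 := Rmin_r _ _.
exists r; split=> // z Hz Hzw.
have Hzw' : z = (w + (z - w))%C by ring.
split.
  by have := Cmod_triangle w (z - w)%C; rewrite -Hzw'; lra.
exists (taylor_coef b (z - w)%C).
apply: (represents_sub _ (r0 - Cmod (z - w)%C)); first by lra.
apply: represents_ext (represents_recenter _ _ _ (z - w)%C Hb _) => //; last by lra.
by move=> h _; congr f; ring.
Qed.

(** The Taylor coefficients of the sum of [a] at a centre [w] coincide with those of
    [f], so the uniform radius [d] and [|f| <= 1] bound them by [d ^ -k] and the
    series [a] converges past [r].  At a new point [z] its sum is still [f z]: both
    have the same expansion at a point [w] on the segment from 0 to [z] with
    [Cmod w < r], and both expansions reach [z]. *)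
Lemma represents_extends (f : C -> C) (a : nat -> C) (r : R) :
  analytic unit_disk f ->
  (forall z, Cmod z < 1 -> Cmod (f z) <= 1) ->
  0 < r < 1 -> represents a r f ->
  exists r', r < r' <= 1 /\ represents a r' f.
Proof.
move=> Hf Hbd Hr Ha.
have [d0 [Hd0 Hexp0]] := analytic_uniform_radius f r Hf ltac:(lra).
(* The bound [d <= r] ensures that the moduli [r - d / 4] and [r - d / 2] used
   below are nonnegative. *)
set d := Rmin d0 r.
have Hd : 0 < d by apply: Rmin_pos; lra.
have Hdr : d <= r := Rmin_r _ _.
have Hexp w : Cmod w < r -> Cmod w + d <= 1 /\
    represents (taylor_coef a w) d (fun h => f (w + h)%C).
  move=> Hw; have [Hw1 [b Hb]] := Hexp0 w ltac:(lra).
  have Hdd : d <= d0 := Rmin_l _ _.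
  split; first by lra.
  have Hbd' := represents_sub _ _ _ _ Hdd Hb.
  have Hrec := represents_recenter _ _ _ w Ha Hw.
  have Hmin : 0 < Rmin d (r - Cmod w) by apply: Rmin_pos; lra.
  apply: represents_ext (Hbd') => // k.
  apply: (represents_unique _ _ _ _ k Hmin).
    exact: represents_sub (Rmin_l _ _) Hbd'.
  exact: represents_sub (Rmin_r _ _) Hrec.
have Hdecay m : Cmod (a m) * (r + d / 2) ^ m <= 2.
  apply: (coefficient_bound_past_radius a r d f m Ha) => //; first by lra.
  move=> w k Hw; have [Hw1 Hrep] := Hexp w Hw.
  apply: (cauchy_estimate _ d 1 _ k Hrep) => //; first by lra.
  move=> h Hh; apply: Hbd.
  by move: (Cmod_triangle w h); lra.
set r' := r + d / 2.
set G := fun z => csum (fun k => (a k * z ^ k)%C).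
have HG : represents a r' G.
  move=> z Hz; apply: csum_correct.
  have Hz0 := Cmod_ge_0 z.
  have := ex_series_of_bounded_terms (fun k => Cmod (a k)) 2 (Cmod z) r'
    ltac:(lra) (fun k => Cmod_ge_0 _) Hdecay.
  by apply: ex_series_ext => k; rewrite Cmod_mult Cmod_pow.
(* The disk of radius [d] around the point [r - d / 2] stays in the unit disk and
   reaches [r + d / 2]. *)
have Hr'1 : r' <= 1.
  have [] := Hexp (RtoC (r - d / 2)) _; rewrite ?Cmod_RtoC_pos /r'; lra.
exists r'; split; first by rewrite /r' in Hr'1 *; lra.
apply: represents_ext (HG) => // z Hz.
case: (Rlt_le_dec (Cmod z) r) => Hzr.
  exact: Cseries_unique (HG z Hz) (Ha z Hzr).
(* The centre [w] has modulus [r - d / 4], hence lies at distance less than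
   [3 d / 4] from [z], because [Cmod z < r + d / 2]. *)
set t := (r - d / 4) / Cmod z.
have Hz0 : 0 < Cmod z by lra.
have Ht0 : 0 <= t by apply: Rdiv_le_0_compat; lra.
have Htz : t * Cmod z = r - d / 4 by rewrite /t; field; lra.
set w := (RtoC t * z)%C; set h := (RtoC (1 - t) * z)%C.
have Hw : Cmod w = r - d / 4 by rewrite /w Cmod_mult Cmod_RtoC_pos.
have Hh : Cmod h = Cmod z - (r - d / 4).
  rewrite /h Cmod_mult Cmod_RtoC_pos; first by lra.
  by nra.
have Hwh : (w + h)%C = z by rewrite /w /h RtoC_minus; ring.
have [_ Hf_w] := Hexp w ltac:(lra).
have Hw' : Cmod w < r' by rewrite /r'; lra.
have HG_w := represents_recenter _ _ _ w HG Hw'.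
have H1 : Cmod h < r' - Cmod w by lra.
have H2 : Cmod h < d by rewrite /r' in Hz; lra.
by have := Cseries_unique _ _ _ (HG_w h H1) (Hf_w h H2); rewrite Hwh.
Qed.

(** The least upper bound of the radii on which the expansion at 0 represents [f] is
    attained, since the disks are open, and below 1 it could be enlarged. *)
Lemma bounded_analytic_power_series (f : C -> C) :
  analytic unit_disk f ->
  (forall z, Cmod z < 1 -> Cmod (f z) <= 1) ->
  exists a, represents a 1 f.
Proof.
move=> Hf Hbd.
have H00 : unit_disk (RtoC 0) by rewrite /unit_disk Cmod_0; lra.
have [r0 [a [Hr0 Ha0]]] := analytic_represents _ f (RtoC 0) Hf H00.
exists a.
have Ha : represents a r0 f.
  by apply: represents_ext Ha0 => // h _; congr f; ring.
set E := fun r => r <= 1 /\ represents a r f.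
have [s [Hub Hlub]] : {s | is_lub E s}.
  apply: completeness; first by exists 1 => r [].
  exists (Rmin r0 1); split; first exact: Rmin_r.
  exact: represents_sub (Rmin_l _ _) Ha.
have Hs1 : s <= 1 by apply: Hlub => r [].
have Hs0 : 0 < s.
  have Hm : 0 < Rmin r0 1 by apply: Rmin_pos; lra.
  suff : Rmin r0 1 <= s by lra.
  by apply: Hub; split; [exact: Rmin_r | exact: represents_sub (Rmin_l _ _) Ha].
have Hs : represents a s f.
  move=> h Hh; apply: NNPP => Hn.
  suff : s <= Cmod h by lra.
  apply: Hlub => r [_ Hr]; apply: Rnot_lt_le => Hhr.
  by apply: Hn; apply: Hr.
case: (Rle_lt_or_eq_dec _ _ Hs1) => [Hlt|Heq]; last by rewrite -Heq.
have [r' [Hr' Hrep]] := represents_extends f a s Hf Hbd (conj Hs0 Hlt) Hs.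
have : r' <= s by apply: Hub; split=> //; lra.
by lra.
Qed.

(** * The maximum principle *)

(** The [n]-th term alone already exhausts Bessel's bound [M ^ 2]. *)
Lemma dominant_coefficient (a : nat -> C) (r M : R) (F : C -> C) (n k : nat) :
  represents a r F -> 0 < r -> (forall h, Cmod h < r -> Cmod (F h) <= M) ->
  Cmod (a n) * r ^ n = M -> k <> n -> a k = RtoC 0.
Proof.
move=> H Hr HF Hn Hk.
have HM : 0 <= M.
  rewrite -Hn; apply: Rmult_le_pos; [exact: Cmod_ge_0 | apply: pow_le; lra].
have := bessel_disk a r M F (n + k) H Hr HM HF.
have := two_terms_le_sum_n (fun j => (Cmod (a j) * r ^ j) ^ 2) n k (n + k)
  (fun j => pow2_ge_0 _) ltac:(lia) ltac:(lia) ltac:(lia).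
rewrite Hn => H1 H2; apply: Cmod_eq_0.
have H3 : (Cmod (a k) * r ^ k) ^ 2 = 0.
  by have := pow2_ge_0 (Cmod (a k) * r ^ k); lra.
have Hrk := pow_lt r k Hr; have := Cmod_ge_0 (a k).
have : Cmod (a k) * r ^ k = 0 by nra.
by nra.
Qed.

(** At a maximum point the constant coefficient of the recentred series is
    dominant, so the other ones vanish. *)
Lemma maximum_locally_constant (a : nat -> C) (r M : R) (F : C -> C) (w z : C) :
  represents a r F -> (forall h, Cmod h < r -> Cmod (F h) <= M) ->
  Cmod (F w) = M -> Cmod (z - w)%C < r - Cmod w -> F z = F w.
Proof.
move=> H HF Hw Hz.
have Hz0 := Cmod_ge_0 (z - w)%C.
have Hs : 0 < r - Cmod w by lra.
have Hrec := represents_recenter a r F w H ltac:(lra).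
have Hc0 := represents_at_0 _ _ _ Hrec Hs; rewrite Cplus_0_r in Hc0.
have Hck k : taylor_coef a w k = monomial O (F w) k.
  case: k => [|k]; first by rewrite -Hc0.
  apply: (dominant_coefficient _ (r - Cmod w) M _ O _ Hrec Hs) => //.
    move=> h Hh; apply: HF; by move: (Cmod_triangle w h); lra.
  by rewrite -Hc0 Rmult_1_r.
have := Hrec _ Hz.
have -> : (w + (z - w))%C = z by ring.
move=> Hser; apply: (Cseries_unique _ _ _ Hser).
have := represents_monomial O (F w) _ _ Hz.
rewrite [((z - w) ^ 0)%C]/= Cmult_1_r.
by apply: Cseries_ext => k; rewrite Hck.
Qed.

(** The value is constant on the disk around [w] that touches the boundary.  That disk
    contains the point [q * w] with [q = Cmod w / r], whose relative modulus is
    [q ^ 2]; iterating this squaring reaches a point within [r / 2] of the centre,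
    whose disk contains 0. *)
Lemma maximum_at_centre (a : nat -> C) (r : R) (F : C -> C) (w : C) :
  represents a r F -> Cmod w < r ->
  (forall h, Cmod h < r -> Cmod (F h) <= Cmod (F w)) ->
  Cmod (F (RtoC 0)) = Cmod (F w).
Proof.
move=> H Hw HF.
have [M HM] : exists M, Cmod (F w) = M by exists (Cmod (F w)).
rewrite HM in HF *.
have Hr : 0 < r by have := Cmod_ge_0 w; lra.
have Hq z : Cmod z < r -> 0 <= Cmod z / r < 1.
  move=> Hz; have := Cmod_ge_0 z; split.
    by apply: Rdiv_le_0_compat; lra.
  by apply/Rlt_div_l; lra.
have [n Hn] : exists n, (Cmod w / r) ^ S n < 1 / 2.
  have Hq0 := Hq w Hw.
  have [N HN] := pow_lt_1_zero (Cmod w / r) ltac:(rewrite Rabs_pos_eq; lra)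
    (1 / 2) ltac:(lra).
  exists N; move: (HN (S N) ltac:(lia)); rewrite Rabs_pos_eq //.
  by apply: pow_le; lra.
elim: n w Hw HM Hn => [|n IH] w Hw HM Hn.
  have Hw2 : Cmod w < r / 2.
    have Hwr : Cmod w = Cmod w / r * r by field; lra.
    by rewrite pow_1 in Hn; nra.
  rewrite (maximum_locally_constant a r M F w) //.
  have -> : (0 - w)%C = (- w)%C by ring.
  by rewrite Cmod_opp; lra.
have Hqw := Hq w Hw; set q := Cmod w / r in Hn Hqw.
have Hwr : Cmod w = q * r by rewrite /q; field; lra.
have Hqw1 : Cmod (RtoC q * w)%C = q * q * r.
  by rewrite Cmod_mult Cmod_RtoC_pos ?Hwr; lra.
have Hqq : q * q <= q by nra.
apply: (IH (RtoC q * w)%C).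
- by rewrite Hqw1; nra.
- rewrite (maximum_locally_constant a r M F w) //.
  have -> : (RtoC q * w - w)%C = (- (RtoC (1 - q) * w))%C by rewrite RtoC_minus; ring.
  rewrite Cmod_opp Cmod_mult Cmod_RtoC_pos; last by lra.
  by rewrite Hwr; nra.
- have -> : Cmod (RtoC q * w)%C / r = q * q by rewrite Hqw1; field; lra.
  rewrite Rpow_mult_distr.
  have Hp0 : 0 <= q ^ S n by apply: pow_le; lra.
  apply: Rle_lt_trans Hn; rewrite -(tech_pow_Rmult _ (S n)).
  apply: Rmult_le_compat_r => //=.
  have : q ^ n <= 1 by rewrite -(pow1 n); apply: pow_incr; lra.
  by have := pow_le q n ltac:(lra); nra.
Qed.

Lemma represents_bounded (a : nat -> C) (r s : R) (F : C -> C) :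
  represents a r F -> 0 <= s < r ->
  exists K, forall z, Cmod z <= s -> Cmod (F z) <= K.
Proof.
move=> H Hs; have [K HK] := represents_abs a r s F H Hs.
exists K => z Hz.
apply: (Cseries_bound _ _ _ _ _ (H z ltac:(lra)) HK) => k.
rewrite Cmod_mult Cmod_pow.
apply: Rmult_le_compat_l; first exact: Cmod_ge_0.
by apply: pow_incr; split; [exact: Cmod_ge_0 | lra].
Qed.

Lemma represents_factor (a : nat -> C) (r : R) (F : C -> C) :
  represents a r F -> exists G, represents (fun k => a (S k)) r G /\
    forall z, Cmod z < r -> F z = (a O + z * G z)%C.
Proof.
move=> H.
have Htail z : Cmod z < r -> is_series (fun k => (a (S k) * z ^ (S k))%C) (F z - a O)%C.
  move=> Hz; apply: (is_series_incr_1 (V := C_NormedModule) (fun k => (a k * z ^ k)%C)).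
  have -> : plus (F z - a O)%C (a O * z ^ 0)%C = F z :> C.
    by rewrite /plus /=; ring.
  exact: H.
have HG z : Cmod z < r -> z <> RtoC 0 ->
    is_series (fun k => (a (S k) * z ^ k)%C) (/ z * (F z - a O))%C.
  move=> Hz Hz0; apply: Cseries_ext (Cseries_scal (/ z)%C _ _ (Htail z Hz)) => k.
  by rewrite Cpow_S; field.
exists (fun z => match excluded_middle_informative (z = RtoC 0) with
                 | left _ => a 1%nat
                 | right _ => (/ z * (F z - a O))%C
                 end).
split=> z Hz; case: excluded_middle_informative => Hz0; last 1 first.
- by field.
- have := represents_monomial O (a 1%nat) r z Hz.
  rewrite [(z ^ 0)%C]/= Cmult_1_r; apply: Cseries_ext => -[|k] //.
  by rewrite Hz0 /monomial /=; ring.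
- exact: HG.
- rewrite Hz0 (represents_at_0 a r F) //; first by ring.
  by have := Cmod_ge_0 z; lra.
Qed.

Lemma represents_continuous (a : nat -> C) (r eps : R) (F : C -> C) (w : C) :
  represents a r F -> Cmod w < r -> 0 < eps ->
  exists d, 0 < d /\ forall z, Cmod (z - w)%C < d -> Cmod (F z - F w)%C < eps.
Proof.
move=> H Hw Heps.
have Hrec := represents_recenter a r F w H Hw.
have Hc0 := represents_at_0 _ _ _ Hrec ltac:(lra); rewrite Cplus_0_r in Hc0.
have [G [HG HF]] := represents_factor _ _ _ Hrec.
have [K HK] := represents_bounded _ _ ((r - Cmod w) / 2) _ HG ltac:(lra).
have HK0 : 0 <= K.
  apply: Rle_trans (Cmod_ge_0 _) (HK (RtoC 0) _); rewrite Cmod_0; lra.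
exists (Rmin ((r - Cmod w) / 2) (eps / (K + 1))); split.
  by apply: Rmin_pos; [lra | apply: Rdiv_lt_0_compat; lra].
move=> z Hz.
have Hz1 : Cmod (z - w)%C < (r - Cmod w) / 2 := Rlt_le_trans _ _ _ Hz (Rmin_l _ _).
have Hz2 : Cmod (z - w)%C < eps / (K + 1) := Rlt_le_trans _ _ _ Hz (Rmin_r _ _).
have := HF (z - w)%C ltac:(lra).
have -> : (w + (z - w))%C = z by ring.
move=> ->; rewrite Hc0.
have -> : (taylor_coef a w 0 + (z - w) * G (z - w) - taylor_coef a w 0)%C
  = ((z - w) * G (z - w))%C by ring.
rewrite Cmod_mult.
have Hlt : Cmod (z - w)%C * (K + 1) < eps by apply/Rlt_div_r; lra.
have := HK (z - w)%C ltac:(lra); have := Cmod_ge_0 (z - w)%C.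
by nra.
Qed.

(** Otherwise, by continuity and compactness, some fixed [d > 0] is such that each
    value of [Cmod (F z)] is exceeded by another one by at least [d], which
    contradicts the existence of a supremum. *)
Lemma represents_attains_max (a : nat -> C) (r s : R) (F : C -> C) :
  represents a r F -> 0 <= s < r ->
  exists w, Cmod w <= s /\ forall z, Cmod z <= s -> Cmod (F z) <= Cmod (F w).
Proof.
move=> H Hs; apply: NNPP => Hno.
have Hbig w : Cmod w <= s -> exists z, Cmod z <= s /\ Cmod (F w) < Cmod (F z).
  move=> Hw; apply: NNPP => Hn; apply: Hno; exists w; split=> // z Hz.
  by apply: Rnot_lt_le => Hlt; apply: Hn; exists z.
have [d [Hd Hgain]] : exists d, 0 < d /\ forall z, Cmod z <= s ->
    exists z', Cmod z' <= s /\ Cmod (F z) + d <= Cmod (F z').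
  apply: closed_disk_uniform => [z d d' [z' [H1 H2]] Hd | w Hw].
    by exists z'; split=> //; lra.
  have [z' [Hz' Hlt]] := Hbig w Hw.
  set e := (Cmod (F z') - Cmod (F w)) / 2.
  have He : 0 < e by rewrite /e; lra.
  have [d [Hd Hcont]] := represents_continuous a r e F w H ltac:(lra) He.
  have Hm1 := Rmin_l d e; have Hm2 := Rmin_r d e.
  exists (Rmin d e); split; first exact: Rmin_pos.
  move=> z Hz Hzw; exists z'; split=> //.
  have Hc := Hcont z ltac:(lra).
  have := Cmod_triangle (F w) (F z - F w)%C.
  have -> : (F w + (F z - F w))%C = F z by ring.
  by rewrite /e in Hc Hm2 *; lra.
have [K HK] := represents_bounded a r s F H Hs.
have [l [Hub Hlub]] : {l | is_lub (fun x => exists z, Cmod z <= s /\ x = Cmod (F z)) l}.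
  apply: completeness; first by exists K => x [z [Hz ->]]; apply: HK.
  by exists (Cmod (F (RtoC 0))); exists (RtoC 0); rewrite Cmod_0; split=> //; lra.
suff : l <= l - d by lra.
apply: Hlub => x [z [Hz ->]].
have [z' [Hz' Hlt]] := Hgain z Hz.
have := Hub (Cmod (F z')) ltac:(by exists z').
by lra.
Qed.

(** If [Cmod (G z) = c > 1], take [r < 1] with [r * c > 1] and a maximum point of
    [Cmod G] on the closed disk of radius [r].  On the circle the bound on
    [Cmod z * Cmod (G z)] is violated; inside, the maximum is also attained at 0,
    against the bound on [b 0]. *)
Lemma schwarz_quotient (b : nat -> C) (G : C -> C) :
  represents b 1 G -> Cmod (b O) <= 1 ->
  (forall z, Cmod z < 1 -> Cmod z * Cmod (G z) <= 1) ->
  forall z, Cmod z < 1 -> Cmod (G z) <= 1.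
Proof.
move=> H Hb0 HzG z Hz; apply: Rnot_lt_le => Hgt.
set c := Cmod (G z) in Hgt.
have Hz0 := Cmod_ge_0 z.
have Hc : 0 < / c < 1.
  split; first by apply: Rinv_0_lt_compat; lra.
  by rewrite -Rinv_1; apply: Rinv_lt_contravar; lra.
have Hcc : / c * c = 1 by field; lra.
(* Any [r] with [1 / c < r < 1] and [Cmod z <= r] would do. *)
set r := Rmax (Cmod z) ((/ c + 1) / 2).
have Hr1 : Cmod z <= r := Rmax_l _ _.
have Hr2 : (/ c + 1) / 2 <= r := Rmax_r _ _.
have Hr3 : r < 1 by apply: Rmax_lub_lt; lra.
have [w [Hw Hmax]] := represents_attains_max b 1 r G H ltac:(lra).
have Hzw : c <= Cmod (G w) := Hmax z Hr1.
have Hrc : 1 < r * c by nra.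
case: (Rle_lt_or_eq_dec _ _ Hw) => Hwr.
  have Hr : r <= 1 by lra.
  have := maximum_at_centre b r G w (represents_sub _ _ _ _ Hr H) Hwr
    (fun h Hh => Hmax h (Rlt_le _ _ Hh)).
  by rewrite (represents_at_0 b 1 G H) //; lra.
have := HzG w ltac:(lra); rewrite Hwr; nra.
Qed.

Theorem theorem10p1 (f : C -> C)
  (f_analytic : analytic unit_disk f)
  (f_bound : forall z : C, unit_disk z -> Cmod (f z) <= 1)
  (f_0 : f (RtoC 0) = RtoC 0) :
  (exists a : nat -> C,
    (* (1) *)
    ((forall z : C, unit_disk z ->
        is_series (fun k : nat => (a (S k) * z ^ (S k))%C) (f z)) /\
     (ex_series (fun k : nat => Cmod (a (S k)) ^ 2) /\
      Series (fun k : nat => Cmod (a (S k)) ^ 2) <= 1) /\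
     (forall z : C, unit_disk z -> Cmod (f z) <= Cmod z)) /\
    (* (2) *)
    (forall n : nat, (1 <= n)%nat ->
       (Cmod (a n) = 1 <->
        exists w : C, unit_circle w /\
          forall z : C, unit_disk z -> f z = (w * z ^ n)%C))) /\
  (* (3) *)
  ((exists z : C, unit_disk z /\ z <> RtoC 0 /\ Cmod (f z) = Cmod z) <->
   exists w : C, unit_circle w /\
     forall z : C, unit_disk z -> f z = (w * z)%C).
Proof.
have [a Ha] := bounded_analytic_power_series f f_analytic f_bound.
have Ha0 : a O = RtoC 0 by rewrite -(represents_at_0 a 1 f Ha); [|lra].
have [g [Hg Hfg]] := represents_factor a 1 f Ha.
have {}Hfg z : Cmod z < 1 -> f z = (z * g z)%C.
  by move=> Hz; rewrite Hfg // Ha0 Cplus_0_l.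
have Hg1 : forall z, Cmod z < 1 -> Cmod (g z) <= 1.
  apply: (schwarz_quotient _ g Hg) => [|z Hz].
    have := cauchy_estimate a 1 1 f 1 Ha Rlt_0_1 Rle_0_1 f_bound.
    by rewrite pow1 Rmult_1_r.
  by rewrite -Cmod_mult -Hfg //; apply: f_bound.
have Hschwarz z : Cmod z < 1 -> Cmod (f z) <= Cmod z.
  move=> Hz; rewrite Hfg // Cmod_mult.
  by have := Hg1 z Hz; have := Cmod_ge_0 z; nra.
have Hdom n : Cmod (a n) = 1 -> forall z, Cmod z < 1 -> f z = (a n * z ^ n)%C.
  move=> Hn z Hz; apply: (Cseries_unique _ _ _ (Ha z Hz)).
  apply: Cseries_ext (represents_monomial n (a n) 1 z Hz) => k.
  rewrite /monomial; case: Nat.eqb_spec => [->//|Hk].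
  rewrite (dominant_coefficient a 1 1 f n k Ha) //; first by lra.
  by rewrite pow1 Rmult_1_r.
split; last split.
- exists a; split; first split; last 1 first.
  + move=> n _; split=> [Hn|[w [Hw Hf]]].
      by exists (a n); split=> // z Hz; apply: Hdom.
    have Hm : represents (monomial n w) 1 f.
      apply: represents_ext (represents_monomial n w 1) => // z Hz.
      by rewrite Hf.
    rewrite (represents_unique _ _ 1 f n Rlt_0_1 Ha Hm).
    by rewrite /monomial Nat.eqb_refl.
  + move=> z Hz; rewrite Hfg //.
    apply: Cseries_ext (Cseries_scal z _ _ (Hg z Hz)) => k.
    by rewrite Cpow_S; ring.
  + split; last exact: Hschwarz.
    apply: bounded_partial_sums => [k|n]; first exact: pow2_ge_0.
    have := bessel_disk (fun k => a (S k)) 1 1 g n Hg Rlt_0_1 Rle_0_1 Hg1.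
    rewrite pow1 (sum_n_ext _ (fun k => Cmod (a (S k)) ^ 2)) //.
    by move=> k; rewrite pow1 Rmult_1_r.
- move=> [z [Hz [Hz0 Heq]]].
  have Hpos : 0 < Cmod z by apply/Cmod_gt_0.
  have Hgz : Cmod (g z) = 1.
    by move: Heq; rewrite Hfg // Cmod_mult => Heq; nra.
  have Ha1 : Cmod (a 1%nat) = 1.
    have := maximum_at_centre _ 1 g z Hg Hz; rewrite Hgz.
    by rewrite (represents_at_0 _ _ _ Hg) //; [apply | lra].
  exists (a 1%nat); split=> // w Hw.
  by rewrite (Hdom 1%nat) // Cpow_1_r.
- move=> [w [Hw Hf]].
  have Hhalf : Cmod (RtoC (1 / 2)) = 1 / 2 by rewrite Cmod_RtoC_pos; lra.
  have Hin : unit_disk (RtoC (1 / 2)) by rewrite /unit_disk Hhalf; lra.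
  exists (RtoC (1 / 2)); split=> //; split.
    by apply/Cmod_gt_0; rewrite Hhalf; lra.
  by rewrite Hf // Cmod_mult Hw Rmult_1_l.
Qed.
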